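(* Total separatedness is closed under (1) retracts, hence under equivalence: a retract of a totally separated type is totally separated; (2) binary products: if $X$ and $Y$ are totally separated then so is $X\times Y$; (3) sums when the index type is discrete: if $X$ is discrete and $Y\,x$ is totally separated for every $x:X$ then $\Sigma_{x:X}Y\,x$ is totally separated; and, as the special case indexed by $\mathbf 2$, binary sums: if $X$ and $Y$ are totally separated then so is $X+Y$; (4) arbitrary products: if $Y\,x$ is totally separated for every $x:X$ ($X$ any type) then $\prod_{x:X}Y\,x$ is totally separated.
   Context: Foundation: intensional Martin-Löf type theory with $\mathbf 0,\mathbf 1,\mathbf 2$ (points $0,1$), $+,\Pi,\Sigma$, identity types, universes, and function extensionality (e.g. as in the HoTT Book). No excluded middle is assumed. A type $X$ is totally separated if for all $x,y:X$, $(\prod_{p:X\to\mathbf 2}p\,x=p\,y)\to x=y$. A type is discrete if it has decidable equality. $Y$ is a retract of $X$ if there are $r:X\to Y$, $s:Y\to X$ with $r\circ s$ the identity. *)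

(* Defs.v *)
(* Function extensionality, including its dependent form, is part of the
   ambient foundation.  No excluded middle is involved in any definition. *)
From Stdlib Require Import FunctionalExtensionality.

(* The identity type is [eq].  It lives in [Prop] but eliminates into [Type]
   and satisfies no definitional proof irrelevance, so it has the full J rule.
   All other structure (retractions, inverses, decisions) is given as data in
   [Type], not as mere existence in [Prop].
   The type 2 is [bool], with points 0 = [false] and 1 = [true]. *)

Definition totally_separated (X : Type) : Prop :=
  forall x y : X, (forall p : X -> bool, p x = p y) -> x = y.

Definition discrete (X : Type) : Type :=
  forall x y : X, {x = y} + {x <> y}.

(* [retract_of Y X] : Y is a retract of X. *)
Definition retract_of (Y X : Type) : Type :=
  {r : X -> Y & {s : Y -> X | forall y : Y, r (s y) = y}}.

(* Equivalences as maps with a right inverse and a (possibly different) left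
   inverse, as in the HoTT Book. *)
Definition is_equiv {X Y : Type} (f : X -> Y) : Type :=
  ({g : Y -> X | forall y : Y, f (g y) = y}
   * {h : Y -> X | forall x : X, h (f x) = x})%type.

Definition equiv (X Y : Type) : Type := {f : X -> Y & is_equiv f}.

(* Main.v *)
Require Import Defs.
From Stdlib Require Import Bool FunctionalExtensionality.

(** To show that two points are equal one only has to recover enough data
    from the maps into [bool], and each construction offers a way of turning
    boolean tests on its ingredients into tests on the whole: precomposition
    with the section for a retract, with the projections for a binary product,
    and with evaluation at a point for a dependent product (where function
    extensionality then assembles the pointwise equalities).

    The sum over a discrete type [X] is the interesting case, because a test on
    a single fibre [Y x] has to be extended to all of [{x : X & Y x}].
    Decidability of equality does this: fibres over points different from [x]
    are sent to [false], and fibres over points equal to [x] are transported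
    back to [Y x].  Discreteness also makes [X] itself totally separated, so
    the two index points may be identified before their fibres are compared.
    Binary sums are retracts of sums indexed by [bool]. *)

Lemma totally_separated_retract (X Y : Type) :
  retract_of Y X -> totally_separated X -> totally_separated Y.
Proof.
  intros [r [s rs]] tsX y y' H.
  rewrite <- (rs y), <- (rs y').
  f_equal; apply tsX; intro p.
  exact (H (fun z => p (s z))).
Qed.

Lemma equiv_retract (X Y : Type) : equiv X Y -> retract_of Y X.
Proof.
  intros [f [[g fg] _]].
  exact (existT _ f (exist _ g fg)).
Defined.

Lemma totally_separated_prod (X Y : Type) :
  totally_separated X -> totally_separated Y -> totally_separated (X * Y).
Proof.
  intros tsX tsY [x y] [x' y'] H.
  f_equal.
  - apply tsX; intro p; exact (H (fun z => p (fst z))).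
  - apply tsY; intro p; exact (H (fun z => p (snd z))).
Qed.

(** The characteristic function of [x], which exists because equality with [x]
    is decidable, already distinguishes [x] from every other point. *)
Lemma discrete_totally_separated (X : Type) :
  discrete X -> totally_separated X.
Proof.
  intros dec x y H.
  specialize (H (fun z => if dec x z then true else false)); simpl in H.
  destruct (dec x y) as [e | _]; [exact e |].
  destruct (dec x x) as [_ | n]; [discriminate H | now destruct n].
Qed.

Definition extend_test {X : Type} {Y : X -> Type} (dec : discrete X)
    {x : X} (p : Y x -> bool) (u : {x : X & Y x}) : bool :=
  match dec x (projT1 u) with
  | left e => p (eq_rect (projT1 u) Y (projT2 u) x (eq_sym e))
  | right _ => false
  end.

Lemma transport_injective {X : Type} (Y : X -> Type) {x y : X} (e : x = y)
    (a b : Y x) :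
  eq_rect x Y a y e = eq_rect x Y b y e -> a = b.
Proof. now destruct e. Qed.

Lemma totally_separated_sigma (X : Type) (Y : X -> Type) :
  discrete X -> (forall x : X, totally_separated (Y x)) ->
  totally_separated {x : X & Y x}.
Proof.
  intros dec tsY [x a] [y b] H.
  assert (e : x = y).
  { apply (discrete_totally_separated X dec); intro p.
    exact (H (fun u => p (projT1 u))). }
  destruct e; f_equal.
  assert (Hfib : forall p : Y x -> bool,
             extend_test dec p (existT Y x a) = extend_test dec p (existT Y x b))
    by (intro p; apply H).
  unfold extend_test in Hfib; simpl in Hfib.
  (* The loop [l] returned by the decision need not be known to be [eq_refl]:
     it is the same for [a] and [b], and transport along it is injective. *)
  destruct (dec x x) as [l | n]; [| now destruct n].
  apply (transport_injective Y (eq_sym l)).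
  now apply tsY.
Qed.

Lemma sum_retract_sigma_bool (X Y : Type) :
  retract_of (X + Y) {b : bool & if b then Y else X}.
Proof.
  exists (fun u : {b : bool & if b then Y else X} =>
            match u with
            | existT _ true y => inr y
            | existT _ false x => inl x
            end).
  exists (fun z : X + Y =>
            match z with
            | inl x => existT (fun b : bool => if b then Y else X) false x
            | inr y => existT (fun b : bool => if b then Y else X) true y
            end).
  now intros [x | y].
Defined.

Lemma totally_separated_sum (X Y : Type) :
  totally_separated X -> totally_separated Y -> totally_separated (X + Y).
Proof.
  intros tsX tsY.
  apply (totally_separated_retract _ _ (sum_retract_sigma_bool X Y)).
  apply totally_separated_sigma.
  - exact bool_dec.
  - now intros [|].
Qed.

Lemma totally_separated_pi (X : Type) (Y : X -> Type) :
  (forall x : X, totally_separated (Y x)) ->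
  totally_separated (forall x : X, Y x).
Proof.
  intros tsY f g H.
  apply functional_extensionality_dep; intro x.
  apply tsY; intro p.
  exact (H (fun h => p (h x))).
Qed.

Theorem proposition3p12 :
  (* (1) *)
  (forall X Y : Type,
     retract_of Y X -> totally_separated X -> totally_separated Y)
  /\
  (forall X Y : Type,
     equiv X Y -> totally_separated X -> totally_separated Y)
  /\
  (* (2) *)
  (forall X Y : Type,
     totally_separated X -> totally_separated Y -> totally_separated (X * Y))
  /\
  (* (3) *)
  (forall (X : Type) (Y : X -> Type),
     discrete X -> (forall x : X, totally_separated (Y x)) ->
     totally_separated {x : X & Y x})
  /\
  (forall X Y : Type,
     totally_separated X -> totally_separated Y -> totally_separated (X + Y))
  /\
  (* (4) *)
  (forall (X : Type) (Y : X -> Type),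
     (forall x : X, totally_separated (Y x)) ->
     totally_separated (forall x : X, Y x)).
Proof.
  split; [exact totally_separated_retract |].
  split.
  { intros X Y E; exact (totally_separated_retract X Y (equiv_retract X Y E)). }
  split; [exact totally_separated_prod |].
  split; [exact totally_separated_sigma |].
  split; [exact totally_separated_sum |].
  exact totally_separated_pi.
Qed.
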